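(* Let $n$ be a positive integer and let $G$ be a tree that has $n$ pairwise vertex-disjoint subtrees, each with at least $n$ vertices. Then for every balance $T$ of order $n$, $\eta(G\,\square\,T)\ge n$.
   Context: All graphs are finite, simple and undirected. A balance of order $n$ is a tree $T$ that has an edge $rs$ and disjoint sets $A,B\subseteq V(T)\setminus\{r,s\}$, each with at least $n$ vertices, such that $A\cup\{r\}$ and $B\cup\{r\}$ each induce connected subtrees of $T$. The Cartesian product $G\,\square\,H$ has vertex set $V(G)\times V(H)$, with $(v,x)(w,y)$ an edge iff ($vw\in E(G)$ and $x=y$) or ($v=w$ and $xy\in E(H)$). $\eta(G)$ is the maximum $k$ such that $K_k$ is a minor of $G$. *)

(* Defs.v *)
From HB Require Import structures.
From mathcomp Require Import all_boot.

Set Implicit Arguments.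
Unset Strict Implicit.
Unset Printing Implicit Defensive.

Record sgraph := SGraph {
  svertex :> finType;
  sedge : rel svertex;
  sedge_sym : symmetric sedge;
  sedge_irrefl : irreflexive sedge }.

Notation "x -- y" := (sedge x y) (at level 30).

Definition complete_rel (k : nat) : rel 'I_k := fun x y => x != y.

Lemma complete_sym k : symmetric (@complete_rel k).
Proof. by move=> x y; rewrite /complete_rel eq_sym. Qed.

Lemma complete_irrefl k : irreflexive (@complete_rel k).
Proof. by move=> x; rewrite /complete_rel eqxx. Qed.

Definition complete (k : nat) : sgraph :=
  SGraph (@complete_sym k) (@complete_irrefl k).

Definition cart_rel (G H : sgraph) : rel (G * H) := fun p q =>
  ((p.1 -- q.1) && (p.2 == q.2)) || ((p.1 == q.1) && (p.2 -- q.2)).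

Lemma cart_sym (G H : sgraph) : symmetric (@cart_rel G H).
Proof.
by move=> p q; rewrite /cart_rel sedge_sym [p.2 == _]eq_sym [p.1 == _]eq_sym
  [p.2 -- _]sedge_sym.
Qed.

Lemma cart_irrefl (G H : sgraph) : irreflexive (@cart_rel G H).
Proof. by move=> p; rewrite /cart_rel !sedge_irrefl andbF. Qed.

Definition cart_prod (G H : sgraph) : sgraph :=
  SGraph (@cart_sym G H) (@cart_irrefl G H).

(* A subgraph need not be induced: it has its own edge relation. *)
Record subgraph (G : sgraph) := Subgraph {
  sub_verts : {set G};
  sub_edge : rel G;
  sub_edge_sym : symmetric sub_edge;
  sub_edge_sub : forall x y, sub_edge x y ->
    [/\ x \in sub_verts, y \in sub_verts & x -- y] }.

Section SubgraphAsGraph.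
Variables (G : sgraph) (S : subgraph G).

Definition sub_rel : rel {x : G | x \in sub_verts S} :=
  fun x y => sub_edge S (val x) (val y).

Lemma sub_rel_sym : symmetric sub_rel.
Proof. by move=> x y; rewrite /sub_rel sub_edge_sym. Qed.

Lemma sub_rel_irrefl : irreflexive sub_rel.
Proof.
move=> x; apply/negP => /sub_edge_sub [_ _]; by rewrite sedge_irrefl.
Qed.

Definition sgraph_of_subgraph : sgraph := SGraph sub_rel_sym sub_rel_irrefl.
End SubgraphAsGraph.

Coercion sgraph_of_subgraph : subgraph >-> sgraph.

Section Induced.
Variables (G : sgraph) (A : {set G}).

Definition induced_rel : rel G :=
  fun x y => [&& x \in A, y \in A & x -- y].

Lemma induced_sym : symmetric induced_rel.
Proof. by move=> x y; rewrite /induced_rel sedge_sym andbCA. Qed.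

Lemma induced_sub x y :
  induced_rel x y -> [/\ x \in A, y \in A & x -- y].
Proof. by case/and3P. Qed.

Definition induced : subgraph G := Subgraph induced_sym induced_sub.
End Induced.

(* The graph with no vertices is not connected, hence not a tree. *)
Definition connected (G : sgraph) : bool :=
  (0 < #|G|) && [forall x : G, forall y : G, connect (@sedge G) x y].

(* The bound on the size is needed because [:: x; y] is a cycle in the sense
   of ucycle whenever x -- y. *)
Definition acyclic (G : sgraph) : Prop :=
  forall c : seq G, ucycle (@sedge G) c -> size c < 3.

Definition is_tree (G : sgraph) : Prop := connected G /\ acyclic G.

Definition is_balance (n : nat) (T : sgraph) : Prop :=
  is_tree T /\
  exists (r s : T) (A B : {set T}),
    [/\ r -- s,
        A \subset ~: [set r; s] /\ B \subset ~: [set r; s],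
        [disjoint A & B],
        n <= #|A| /\ n <= #|B|
      & is_tree (induced (r |: A)) /\ is_tree (induced (r |: B))].

(* H is a minor of G, by means of branch sets: B u is the set of vertices of G
   contracted to the vertex u of H. *)
Definition minor (G H : sgraph) : bool :=
  [exists B : {ffun H -> {set G}},
    [&& [forall u : H, connected (induced (B u))],
        [forall u : H, forall v : H, (u != v) ==> [disjoint B u & B v]]
      & [forall u : H, forall v : H, (u -- v) ==>
          [exists x in B u, exists y in B v, x -- y]]]].

(* The Hadwiger number. Restricting to k <= #|G| loses nothing, since branch
   sets are nonempty and disjoint; see minor_hadwiger and leq_hadwiger. *)
Definition hadwiger (G : sgraph) : nat :=
  \max_(k < #|G|.+1 | minor G (complete k)) k.

Lemma minor_complete_card (G : sgraph) k : minor G (complete k) -> k <= #|G|.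
Proof.
case/existsP=> B /and3P [/forallP Bc /forallP Bd _].
have Bn (u : 'I_k) : exists x, x \in B u.
  by case/andP: (Bc u) => /card_gt0P [x _] _; exists (val x); apply: (valP x).
pose f u := xchoose (Bn u).
rewrite -[k]card_ord; apply: (leq_card f) => u v fuv.
apply/eqP/negPn/negP => neq_uv.
have /disjointFr /(_ (xchooseP (Bn u))) := implyP (forallP (Bd u) v) neq_uv.
by rewrite -/(f u) fuv (xchooseP (Bn v)).
Qed.

Lemma leq_hadwiger (G : sgraph) k : minor G (complete k) -> k <= hadwiger G.
Proof.
move=> mk; have lt_k : k < #|G|.+1 by rewrite ltnS minor_complete_card.
exact: (leq_bigmax_cond (Ordinal lt_k)).
Qed.

Lemma minor_hadwiger (G : sgraph) : minor G (complete (hadwiger G)).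
Proof.
have m0 : minor G (complete 0).
  apply/existsP; exists [ffun _ => set0].
  by apply/and3P; split; apply/forallP; case.
rewrite /hadwiger; apply: (big_ind (fun k => minor G (complete k))) => // m p.
by rewrite /maxn; case: ifP.
Qed.

(* Main.v *)
(** Think of the [n] vertices of the clique as tokens. In the copy of [T] over a
    vertex of [G] every token stands on its own vertex of an arm [A] or [B] of
    the balance, and moving along an edge of [G] keeps all positions.
    Over a connected set [X] of at least [n] vertices the tokens can leave the
    arm and take one vertex each of the row [X * {r}] (lemma [turn_in]); a token
    that is also given the row [X * {s}] then touches all the others. From the
    row of [r] the tokens can move to the other arm, over any prescribed vertex
    of [X] ([turn_out]), or, if they need not go on, a second token can be given
    the row [X * {b}] of a neighbour [b] of [r] on the other arm.
    Root [G] at [x]. A connected set containing [k > 0] of the given subtrees can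
    serve [k + 1] tokens, by induction: a subtree [X0] at the root behind which
    no other one lies serves two; one with a single component of subtrees
    behind it serves one and passes the tokens on through the other arm; and
    when there are at least two such components, [X0] only passes the tokens on
    unchanged, since the extra token of each component makes up for it. *)
Require Import Defs.
From HB Require Import structures.
From mathcomp Require Import all_boot zify.

Set Implicit Arguments.
Unset Strict Implicit.
Unset Printing Implicit Defensive.

(** * Connected vertex sets and components *)

Section ConnectedSets.
Variable G : sgraph.
Implicit Types (S Z D R : {set G}) (x y v : G).

(** Stated on [G] itself rather than on a subtype, so that unions are easy to form; in contrast to
    [connected], the empty set qualifies. *)
Definition conn_set S :=
  forall x y, x \in S -> y \in S -> connect (induced_rel S) x y.

Lemma induced_connect_sym S : connect_sym (induced_rel S).
Proof. exact/sym_connect_sym/induced_sym. Qed.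

Lemma induced_connectS S Z x y :
  S \subset Z -> connect (induced_rel S) x y -> connect (induced_rel Z) x y.
Proof.
move=> sSZ; apply: connect_sub => u v /and3P [uS vS uv]; apply: connect1.
by rewrite /induced_rel !(subsetP sSZ).
Qed.

Lemma conn_set_root S x :
  (forall y, y \in S -> connect (induced_rel S) x y) -> conn_set S.
Proof.
move=> xS y z yS zS; apply: (connect_trans (y := x)); last exact: xS.
by rewrite induced_connect_sym xS.
Qed.

Lemma conn_set1 x : conn_set [set x].
Proof. by move=> y z /set1P -> /set1P ->. Qed.

Lemma conn_setU S Z x y : conn_set S -> conn_set Z -> x \in S -> y \in Z ->
  (x == y) || (x -- y) -> conn_set (S :|: Z).
Proof.
move=> cS cZ xS yZ xy; apply: (@conn_set_root _ x) => z /setUP [zS | zZ].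
  by apply: (induced_connectS (subsetUl S Z)); apply: cS.
apply: (connect_trans (y := y)).
  case/orP: xy => [/eqP -> // | xy]; apply: connect1.
  by rewrite /induced_rel !inE xS yZ orbT xy.
by apply: (induced_connectS (subsetUr S Z)); apply: cZ.
Qed.

Lemma conn_set_connected S x : x \in S -> conn_set S -> connected (induced S).
Proof.
move=> xS cS; apply/andP; split; first by apply/card_gt0P; exists (exist _ x xS).
apply/forallP => -[u uS]; apply/forallP => -[v vS].
have {cS} /connectP [p pp vp] := cS u v uS vS.
elim: p u uS pp vp => [|w p IH] u uS /= => [_ vu | /andP [uw pp] vp].
  by apply: eq_connect0; apply: val_inj.
have wS : w \in S by case/and3P: uw.
apply: connect_trans (IH w wS pp vp).
exact: (@connect1 _ (@sub_rel G (induced S)) (exist _ u uS) (exist _ w wS)).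
Qed.

Lemma connected_conn_set (X : subgraph G) :
  connected X -> conn_set (sub_verts X).
Proof.
case/andP=> _ /forallP cX x y xX yX.
suff H (u w : X) : connect (@sub_rel G X) u w -> connect (induced_rel (sub_verts X)) (val u) (val w).
  exact: (H (exist _ x xX) (exist _ y yX) (forallP (cX (exist _ x xX)) _)).
case/connectP=> p; elim: p u => [|z p IH] u /= => [_ -> // | /andP [uz pp] wp].
apply: connect_trans (IH z pp wp); apply: connect1.
by case: (sub_edge_sub uz) => uX zX e; apply/and3P.
Qed.

(** For [v] outside [Z] this is the singleton of [v]. *)
Definition component Z v := [set u | connect (induced_rel Z) v u].

Lemma component_refl Z v : v \in component Z v.
Proof. by rewrite inE. Qed.

Lemma component_sub Z v : v \in Z -> component Z v \subset Z.
Proof.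
move=> vZ; apply/subsetP => u; rewrite inE => /connectP [p pp ->].
elim: p v vZ pp => //= w p IH v vZ /andP [/and3P [_ wZ _]]; exact: IH.
Qed.

Lemma component_eq Z u v : u \in component Z v -> component Z u = component Z v.
Proof.
rewrite inE => vu; apply/setP => w; rewrite !inE.
by rewrite (same_connect (@induced_connect_sym Z) vu).
Qed.

Lemma conn_component Z v : conn_set (component Z v).
Proof.
apply: (@conn_set_root _ v) => u; rewrite inE => /connectP [p pp ->].
suff H y : y \in component Z v -> path (induced_rel Z) y p ->
    connect (induced_rel (component Z v)) y (last y p).
  exact: H (component_refl _ _) pp.
elim: p {pp} y => [//|w p IH] y yC /= /andP [yw pp].
have wC : w \in component Z v.
  by rewrite -(component_eq yC) inE connect1.
apply: connect_trans (IH w wC pp); apply: connect1.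
by rewrite /induced_rel yC wC; case/and3P: yw.
Qed.

Lemma conn_sub_component Z Y v y :
  conn_set Y -> Y \subset Z -> y \in Y -> y \in component Z v ->
  Y \subset component Z v.
Proof.
move=> cY sYZ yY yC; apply/subsetP => z zY; rewrite -(component_eq yC) inE.
by apply: (induced_connectS sYZ); apply: cY.
Qed.

(** A path in [D] from [v] to [R] stays in one component of [D :\: R] until it first enters [R]; the
    entering edge is the one sought. *)
Lemma component_neighbour D R v : conn_set D -> R \subset D -> R != set0 ->
  v \in D :\: R ->
  exists y z, [/\ y \in R, z \in component (D :\: R) v & y -- z].
Proof.
move=> cD sRD /set0Pn [x xR] vDR.
have /connectP [p pp xp] := cD v x (subsetP (subsetDl D R) _ vDR) (subsetP sRD _ xR).
rewrite {}xp in xR.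
elim: p v vDR pp xR => [|u p IH] v vDR /= => [_ vR | /andP [/and3P [_ uD vu] pp] xR].
  by move: vDR; rewrite inE vR.
have [uR | uR] := boolP (u \in R).
  by exists u, v; rewrite component_refl sedge_sym.
have uDR : u \in D :\: R by rewrite inE uR.
have [y [z [yR zC yz]]] := IH u uDR pp xR; exists y, z; split=> //.
rewrite -(@component_eq _ u v) // inE; apply: connect1.
by rewrite /induced_rel vDR uDR.
Qed.

(** Once [Z] is removed, [r] is a component by itself, so the edge given by [component_neighbour]
    has [r] as an end. *)
Lemma conn_set_neighbour r Z : conn_set (r |: Z) -> r \notin Z -> Z != set0 ->
  exists2 z, z \in Z & r -- z.
Proof.
move=> cZ rZ Z0; have zr : (r |: Z) :\: Z = [set r].
  by apply/setP => z; rewrite !inE; case: eqP => [->|_]; rewrite ?rZ ?andNb.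
have [|y [z [yZ]]] := component_neighbour (v := r) cZ (subsetUr _ _) Z0.
  by rewrite zr set11.
move/(subsetP (component_sub _)); rewrite zr set11 => /(_ isT) /set1P -> yr.
by exists y; rewrite // sedge_sym.
Qed.

(* Growing [Y] from [r] one vertex at a time; [d] is the time of entry. *)
Lemma rooted_paths Y r : conn_set Y -> r \in Y ->
  exists (d : G -> nat) (P : G -> {set G}), forall a, a \in Y ->
    [/\ a \in P a, r \in P a, P a \subset Y, conn_set (P a)
      & forall z, z \in P a -> z != a -> d z < d a].
Proof.
move=> cY rY.
(* [W] is the stage of the growth with [k.+1] vertices; the last stage is [Y]. *)
suff H k : k < #|Y| -> exists (W : {set G}) (d : G -> nat) (P : G -> {set G}),
    [/\ W \subset Y, r \in W, #|W| = k.+1 & forall a, a \in W ->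
    [/\ a \in P a, r \in P a, P a \subset W, conn_set (P a)
      & forall z, z \in P a -> z != a -> d z < d a]].
  have Y0 : 0 < #|Y| by apply/card_gt0P; exists r.
  have [|W [d [P [sWY _ cW HW]]]] := H #|Y|.-1; first by rewrite prednK.
  have <- : W = Y by apply/eqP; rewrite eqEcard sWY cW prednK /=.
  by exists d, P.
elim: k => [_ | k IH ltk].
  exists [set r], (fun=> 0), (fun=> [set r]); split; rewrite ?sub1set ?set11 ?cards1 //.
  move=> a /set1P -> /=; rewrite set11; split=> //; first exact: conn_set1.
  by move=> z /set1P ->; rewrite eqxx.
have [W [d [P [sWY rW cW HW]]]] := IH (ltnW ltk).
have /properP [_ [v vY vW]] : W \proper Y by rewrite properEcard sWY cW.
have [||y [z [yW zC yz]]] := component_neighbour (v := v) cY sWY.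
- by apply/set0Pn; exists r.
- by rewrite inE vW.
have /setDP [zY zW] : z \in Y :\: W.
  by apply: (subsetP (component_sub _)) zC; rewrite inE vW.
have neq a : a \in W -> (a == z) = false.
  by move=> aW; apply/eqP => az; rewrite -az aW in zW.
(* The new vertex [z] enters later than all of [W], and its path extends that of its neighbour
   [y]. *)
exists (z |: W), (fun a => if a == z then (\max_(w in W) d w).+1 else d a).
exists (fun a => if a == z then z |: P y else P a).
split; first by rewrite subUset sub1set zY.
- by rewrite !inE rW orbT.
- by rewrite cardsU1 zW cW.
have [yP rP sP cP dP] := HW y yW.
move=> a /setU1P [-> | aW].
  rewrite /= eqxx; split; rewrite ?setU11 ?setUS //; first by rewrite !inE rP orbT.
    apply: (@conn_setU [set z] (P y) z y); rewrite ?set11 //; first exact: conn_set1.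
    by rewrite sedge_sym yz orbT.
  move=> w /setU1P [-> | wP]; first by rewrite eqxx.
  by move=> /negbTE ->; rewrite ltnS leq_bigmax_cond // (subsetP sP).
rewrite /= neq //; have [aP rPa sPa cPa dPa] := HW a aW; split=> //.
  by apply: subset_trans sPa (subsetUr _ _).
by move=> w wP wa; rewrite neq ?(subsetP sPa) //; apply: dPa.
Qed.
End ConnectedSets.

(* Sorting both sides matches large values of [b] with large values of [a]. *)
Lemma monotone_matching (I V : finType) (a : I -> nat) (b : V -> nat)
    (S : {set I}) (Y : {set V}) (v0 : V) : #|S| <= #|Y| ->
  exists f : I -> V, [/\ {in S, forall i, f i \in Y}, {in S &, injective f}
    & {in S &, forall i j, a i < a j -> b (f i) <= b (f j)}].
Proof.
move: {2}#|S| (erefl #|S|) => k; elim: k S Y => [|k IH] S Y cS leSY.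
  have S0 := cards0_eq cS; exists (fun=> v0).
  by split=> [i|i j|i j]; rewrite S0 inE.
have /card_gt0P [i0 i0S] : 0 < #|S| by rewrite cS.
have /card_gt0P [y0 y0Y] : 0 < #|Y| by apply: leq_trans leSY; rewrite cS.
(* Greedy choice: pair an index of maximal [a] with a value of maximal [b] and recurse on the
   rest. *)
have [i iS imax] := arg_maxnP a i0S.
have [y yY ymax] := arg_maxnP b y0Y.
have {}iS : i \in S by [].
have {}yY : y \in Y by [].
have cS' : #|S :\ i| = k by have := cardsD1 i S; rewrite iS cS add1n => -[].
have leSY' : k <= #|Y :\ y|.
  by move: leSY; rewrite cS (cardsD1 y Y) yY.
have [|f [fY finj fm]] := IH _ (Y :\ y) cS'; first by rewrite cS'.
exists (fun j => if j == i then y else f j).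
have fY' j : j \in S -> j != i -> f j \in Y /\ f j != y.
  by move=> jS ji; have := fY j; rewrite !inE ji jS => /(_ isT) /andP [].
split=> [j jS|j k' jS k'S|j k' jS k'S].
- by case: eqVneq => // ji; case: (fY' j).
- case: eqVneq => [->|ji]; case: eqVneq => [->|ki] //.
  + by case: (fY' k' k'S ki) => _ /eqP fy /esym.
  + by case: (fY' j jS ji) => _ /eqP.
  + by apply: finj; rewrite !inE ?ji ?ki.
- case: eqVneq => [->|ji]; case: eqVneq => [->|ki] //.
  + by move=> lt; have := imax k' k'S; rewrite /= leqNgt lt.
  + by move=> _; apply: ymax; case: (fY' j jS ji).
  + by apply: fm; rewrite !inE ?ji ?ki.
Qed.

(** * Connected sets in the product *)

Section Product.
Variables (G T : sgraph).
Local Notation H := (cart_prod G T).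
Implicit Types (S X D R E : {set G}) (Y : {set T}) (x y v : G) (a : T).

Lemma connect_setX S Y x y a c :
  connect (induced_rel S) x y -> connect (induced_rel Y) a c ->
  x \in S -> a \in Y ->
  connect (@induced_rel H (setX S Y)) (x, a) (y, c).
Proof.
(* First within the row of [a], then within the column of [y]. *)
move=> xy ac xS aY; apply: (connect_trans (y := (y, a))).
  have /connectP [p pp ->] := xy.
  elim: p x xS {xy} pp => //= z p IH x xS /andP [/and3P [_ zS xz] pp].
  apply: connect_trans (IH z zS pp); apply: connect1.
  by rewrite /induced_rel !in_setX xS zS aY /= /cart_rel /= xz eqxx.
have yS : y \in S.
  have /connectP [p pp ->] := xy.
  by elim: p x xS {xy} pp => //= z p IH x _ /andP [/and3P [_ zS _]]; apply: IH.
have /connectP [p pp ->] := ac.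
elim: p a aY {ac} pp => //= z p IH a aY /andP [/and3P [_ zY az] pp].
apply: connect_trans (IH z zY pp); apply: connect1.
by rewrite /induced_rel !in_setX yS zY aY /= /cart_rel /= az eqxx orbT.
Qed.

Lemma conn_setX S Y : conn_set S -> conn_set Y -> @conn_set H (setX S Y).
Proof.
move=> cS cY [x a] [y c]; rewrite !in_setX => /andP [xS aY] /andP [yS cY'].
by apply: connect_setX => //; [apply: cS | apply: cY].
Qed.

Definition touch (P Q : {set H}) := exists p q, [/\ p \in P, q \in Q & p -- q].

Lemma touchC P Q : touch P Q -> touch Q P.
Proof. by case=> p [q [pP qQ pq]]; exists q, p; rewrite sedge_sym. Qed.

Lemma touchS (P P' Q Q' : {set H}) :
  P \subset P' -> Q \subset Q' -> touch P Q -> touch P' Q'.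
Proof.
move=> /subsetP sP /subsetP sQ [p [q [pP qQ pq]]].
by exists p, q; split; auto.
Qed.

(** * Turning tokens between an arm and the row of [r] *)

Variables (I : finType) (r s : T) (arm : bool -> {set T}).
Hypotheses (rs : r -- s) (conn_arm : forall b, conn_set (r |: arm b)).
Hypotheses (arm_r : forall b, r \notin arm b) (arm_s : forall b, s \notin arm b).
Hypothesis arm_disj : forall b a, a \in arm b -> a \notin arm (~~ b).
Hypothesis arm_card : forall b, #|I| <= #|arm b|.
Implicit Types (K U : {set I}) (i j : I) (b : bool).

(* [K] is a set of tokens, [sigma] gives their positions on the arm [b] in the
   column of [x], and [f] their places in the row of [r]. *)
Definition turn X x b K (sigma : I -> T) (f : I -> G) (C : I -> {set H}) :=
  {in K, forall i, [/\ f i \in X, @conn_set H (C i), (x, sigma i) \in C i,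
     (f i, r) \in C i & {in C i, forall p, (p.1 \in X) && (p.2 \in r |: arm b)}]}
  /\ {in K &, forall i j p, p \in C i -> p \in C j -> i = j}
  /\ {in K, forall i v, (v, r) \in C i -> v = f i}.

(* The token [i] runs along the path from [x] to [f i] in its own row and then
   along the path from [sigma i] to [r] in the column of [f i]. If the tokens
   [i] and [j] met, then [i] would be farther from [x] in [X] and nearer to [r]
   in the arm than [j], contrary to monotonicity. *)
Lemma turn_of_matching X x b K sigma f
    (dX : G -> nat) (PX : G -> {set G}) (dT : T -> nat) (PT : T -> {set T}) :
  (forall v, v \in X ->
    [/\ v \in PX v, x \in PX v, PX v \subset X, conn_set (PX v)
      & forall z, z \in PX v -> z != v -> dX z < dX v]) ->
  (forall a, a \in r |: arm b ->
    [/\ a \in PT a, r \in PT a, PT a \subset r |: arm b, conn_set (PT a)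
      & forall z, z \in PT a -> z != a -> dT z < dT a]) ->
  {in K, forall i, f i \in X} -> {in K &, injective f} ->
  {in K, forall i, sigma i \in arm b} -> {in K &, injective sigma} ->
  {in K &, forall i j, dT (sigma i) < dT (sigma j) -> dX (f i) <= dX (f j)} ->
  turn X x b K sigma f
    (fun i => setX (PX (f i)) [set sigma i] :|: setX [set f i] (PT (sigma i))).
Proof.
move=> rX rT fX finj sA sinj mono.
have sA' i : i \in K -> sigma i \in r |: arm b.
  by move=> iK; rewrite inE sA ?orbT.
split; [move=> i iK | split=> [i j iK jK [v a] | i iK v]].
  have [fP xP sP cP _] := rX _ (fX i iK).
  have [aP rP sQ cQ _] := rT _ (sA' i iK).
  split; first exact: fX.
  - apply: (@conn_setU H _ _ (f i, sigma i) (f i, sigma i)).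
    + exact: conn_setX (@conn_set1 T _).
    + exact: conn_setX (@conn_set1 G _) cQ.
    + by rewrite in_setX fP set11.
    + by rewrite in_setX aP set11.
    + by rewrite eqxx.
  - by rewrite in_setU !in_setX xP set11.
  - by rewrite in_setU !in_setX rP set11 orbT.
  move=> [v a] /setUP [] /setXP /= [].
    by move=> vP /set1P ->; rewrite (subsetP sP) // sA'.
  by move=> /set1P -> aQ; rewrite fX // (subsetP sQ).
  (* The mixed case: the row part of [k] meets the column part of [l]. Two row parts meet only for
     equal positions, two column parts only for equal places. *)
  have cross k l : k \in K -> l \in K -> f l \in PX (f k) -> sigma k \in PT (sigma l) -> k = l.
    move=> kK lK fP sP; case: (eqVneq k l) => // kl; exfalso.
    have [_ _ _ _ /(_ _ fP)] := rX _ (fX k kK).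
    have [_ _ _ _ /(_ _ sP)] := rT _ (sA' l lK).
    rewrite (inj_in_eq sinj) // (inj_in_eq finj) // kl eq_sym kl.
    by move=> /(_ isT) /(mono k l kK lK) le /(_ isT); rewrite ltnNge le.
  rewrite !in_setU !in_setX => /orP [] /andP [v1 a1] /orP [] /andP [v2 a2].
  - by apply: sinj => //; rewrite -(set1P a1) -(set1P a2).
  - by move: v1 a2; rewrite (set1P a1) (set1P v2); apply: cross.
  - by apply/esym; move: v2 a1; rewrite (set1P a2) (set1P v1); apply: cross.
  - by apply: finj => //; rewrite -(set1P v1) -(set1P v2).
(* The row part lies at height [sigma i], which is on the arm and so differs from [r]. *)
case/setUP => /setXP [] /=; last by move=> /set1P.
by move=> _ /set1P re; have := arm_r b; rewrite {1}re sA.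
Qed.

(** Positions are given and places are chosen: tokens deeper in the arm are matched with vertices of
    [X] farther from [x]. *)
Lemma turn_in X x b K sigma : conn_set X -> x \in X -> #|I| <= #|X| ->
  {in K, forall i, sigma i \in arm b} -> {in K &, injective sigma} ->
  exists (f : I -> G) (C : I -> {set H}), turn X x b K sigma f C.
Proof.
move=> cX xX leX sA sinj.
have [dX [PX rX]] := rooted_paths cX xX.
have [dT [PT rT]] := rooted_paths (@conn_arm b) (setU11 r (arm b)).
have [|f [fX finj mono]] :=
  @monotone_matching _ _ (fun i => dT (sigma i)) dX K X x _.
  exact: leq_trans (max_card _) leX.
by exists f; eexists; exact: (turn_of_matching rX rT fX finj sA sinj mono).
Qed.

(** The same matching with the roles exchanged: places are given and positions on the arm are
    chosen. *)
Lemma turn_out X x b K f : conn_set X -> x \in X ->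
  {in K, forall i, f i \in X} -> {in K &, injective f} ->
  exists (sigma : I -> T) (C : I -> {set H}),
    [/\ {in K, forall i, sigma i \in arm b}, {in K &, injective sigma}
      & turn X x b K sigma f C].
Proof.
move=> cX xX fX finj.
have [dX [PX rX]] := rooted_paths cX xX.
have [dT [PT rT]] := rooted_paths (@conn_arm b) (setU11 r (arm b)).
have [|sigma [sA sinj mono]] :=
  @monotone_matching _ _ (fun i => dX (f i)) dT K (arm b) r _.
  exact: leq_trans (max_card _) (arm_card b).
exists sigma; eexists; split=> //; apply: (turn_of_matching rX rT) => //.
(* The matching is monotone from places to positions; the converse direction is its
   contrapositive. *)
move=> i j iK jK lt; rewrite leqNgt; apply/negP => gt.
by have := mono j i jK iK gt; rewrite leqNgt lt.
Qed.

Lemma turn_row X x b K sigma f C : turn X x b K sigma f C ->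
  {in K &, injective f}.
Proof.
case=> tC [tI _] i j iK jK fij; have [_ _ _ fi _] := tC i iK.
by apply: (tI i j iK jK _ fi); rewrite fij; case: (tC j jK).
Qed.

(** * Serving tokens in a region of [G] *)

(* [U] is the set of tokens not served: only pairs inside [U] may fail to touch.
   The difference [#|K| - m] is truncated, so fewer than [m] tokens are allowed. *)
Definition processes D R (m : nat) :=
  forall b K (sigma : I -> T),
  {in K, forall i, sigma i \in arm b} -> {in K &, injective sigma} ->
  exists (U : {set I}) (B : I -> {set H}), [/\ U \subset K, #|U| <= #|K| - m,
    {in K, forall i, [/\ @conn_set H (B i), forall v, v \in R -> (v, sigma i) \in B i
      & {in B i, forall p, p.1 \in D}]},
    {in K &, forall i j p, p \in B i -> p \in B j -> i = j}
  & {in K &, forall i j, i != j -> ~~ ((i \in U) && (j \in U)) -> touch (B i) (B j)}].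

(** Every token keeps its position over all of [R] and none is served; components are later attached
    to this. *)
Lemma processes_const R : conn_set R -> processes R R 0.
Proof.
move=> cR b K sigma sA sinj.
exists K, (fun i => setX R [set sigma i]); split=> //.
- by rewrite subn0.
- move=> i iK; split; first exact: conn_setX (@conn_set1 T _).
    by move=> v vR; rewrite in_setX vR set11.
  by move=> [v a] /setXP [].
- move=> i j iK jK [v a] /setXP [_ /set1P ->] /setXP [_ /set1P]; exact: sinj.
- by move=> i j -> ->.
Qed.

Lemma processes_weaken D D' R R' m m' :
  D \subset D' -> R' \subset R -> m' <= m -> processes D R m -> processes D' R' m'.
Proof.
move=> /subsetP sD /subsetP sR le_m pD b K sigma sA sinj.
have [U [B [sU cU BK Bd Bt]]] := pD b K sigma sA sinj.
exists U, B; split=> //; first exact: leq_trans cU (leq_sub2l _ le_m).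
move=> i iK; have [cB RB DB] := BK i iK.
by split=> // [v /sR | p /DB /sD] //; apply: RB.
Qed.

(** The tokens left unserved by [D] cross the edge from [y] to [z] at their own positions and are
    processed in [E]. The numbers served add up because truncated differences compose. *)
Lemma processes_attach D R E y z m k :
  processes D R m -> processes E [set z] k -> [disjoint D & E] ->
  y \in R -> y -- z -> processes (D :|: E) R (m + k).
Proof.
move=> pD pE dDE yR yz b K sigma sA sinj.
have [U [B [sU cU BK Bd Bt]]] := pD b K sigma sA sinj.
have sUK i : i \in U -> i \in K by apply: (subsetP sU).
have [|i j iU jU|U' [B' [sU' cU' BK' Bd' Bt']]] := pE b U sigma.
- by move=> i /sUK; apply: sA.
- by apply: sinj; apply: sUK.
have BD i p : i \in K -> p \in B i -> (p.1 \in D) && (p.1 \notin E).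
  move=> iK pB; have [_ _ /(_ p pB) pD'] := BK i iK.
  by rewrite pD' (disjointFr dDE pD').
have BE i p : i \in U -> p \in B' i -> p.1 \in E.
  by move=> iU pB; have [_ _ /(_ p pB)] := BK' i iU.
exists U', (fun i => if i \in U then B i :|: B' i else B i); split.
- exact: subset_trans sU' sU.
- by apply: leq_trans cU' _; rewrite subnDA leq_sub2r.
- move=> i iK; have [cB RB _] := BK i iK.
  have [iU|_] := boolP (i \in U); last first.
    by split=> // p pB; rewrite inE; case/andP: (BD i p iK pB) => ->.
  have [cB' RB' _] := BK' i iU; split.
  + apply: (@conn_setU H _ _ (y, sigma i) (z, sigma i)) => //; first exact: RB.
      by apply: RB'; rewrite set11.
    by rewrite /= /cart_rel /= yz eqxx orbT.
  + by move=> v vR; rewrite inE RB.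
  + move=> p /setUP [pB | pB]; rewrite inE.
      by case/andP: (BD i p iK pB) => ->.
    by rewrite (BE i) ?orbT.
- move=> i j iK jK p.
  have mixed k1 k2 : k1 \in K -> k2 \in U -> p \in B k1 -> p \in B' k2 -> k1 = k2.
    by move=> k1K k2U /(BD _ _ k1K) /andP [_ /negP nE] /(BE _ _ k2U).
  have [iU|_] := boolP (i \in U); have [jU|_] := boolP (j \in U); rewrite ?in_setU.
  + case/orP => pi; case/orP => pj; [exact: Bd pi pj | exact: mixed pi pj | | exact: Bd' pi pj].
    exact/esym/(mixed _ _ jK iU pj pi).
  + by case/orP => pi pj; [apply: Bd pi pj | apply/esym/(mixed _ _ jK iU pj pi)].
  + by move=> pi /orP [] pj; [apply: Bd pi pj | apply: mixed pi pj].
  + exact: Bd.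
- move=> i j iK jK ij nU.
  have sB k1 : B k1 \subset if k1 \in U then B k1 :|: B' k1 else B k1.
    by case: ifP => _ //; apply: subsetUl.
  (* A pair not inside [U] already touches in [D]; a pair inside [U] touches in [E]. *)
  have [/andP [iU jU]|nU'] := boolP ((i \in U) && (j \in U)); last first.
    by apply: touchS (sB i) (sB j) _; apply: Bt.
  by rewrite iU jU; apply: touchS (subsetUr _ _) (subsetUr _ _) (Bt' _ _ _ _ _ _).
Qed.

Lemma conn_setU_row (P : {set H}) X v a : conn_set X -> @conn_set H P ->
  v \in X -> (v, r) \in P -> r -- a -> @conn_set H (P :|: setX X [set a]).
Proof.
move=> cX cP vX vP ra.
apply: (@conn_setU H _ _ (v, r) (v, a)) => //.
- exact: conn_setX (@conn_set1 T _).
- by rewrite in_setX vX set11.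
- by rewrite /= /cart_rel /= ra eqxx !orbT.
Qed.

(** This is how a served token meets all others: it has the whole row of a neighbour [a] of [r] over
    [X], and each other token has a place in the row of [r]. *)
Lemma touch_row (P Q : {set H}) X v a : setX X [set a] \subset P ->
  v \in X -> (v, r) \in Q -> r -- a -> touch P Q.
Proof.
move=> /subsetP sP vX vQ ra; exists (v, a), (v, r); split=> //.
  by apply: sP; rewrite in_setX vX set11.
by rewrite /= /cart_rel /= sedge_sym ra eqxx orbT.
Qed.

Lemma arm_neq_r b a : a \in arm b -> a != r.
Proof. by apply: contraTneq => ->. Qed.

(** After [turn_in] two rows next to that of [r] are free: that of [s] and that of a neighbour [b1]
    of [r] on the other arm. The tokens [c] and [w] get one each. *)
Lemma processes_leaf X x : 0 < #|I| -> conn_set X -> x \in X -> #|I| <= #|X| ->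
  processes X [set x] 2.
Proof.
move=> I0 cX xX leX b K sigma sA sinj.
have [K0|/set0Pn [c cK]] := eqVneq K set0.
  exists set0, (fun=> set0); rewrite K0 cards0; split=> //.
  - by move=> i; rewrite inE.
  - by move=> i j; rewrite inE.
  - by move=> i j; rewrite inE.
(* If [c] is the only token, then [w] is [c] and takes both rows. *)
have [w wK cardU] : exists2 w, w \in K & #|K :\: [set c; w]| <= #|K| - 2.
  have [K1|/set0Pn [w]] := eqVneq (K :\ c) set0.
    by exists c; rewrite // setUid K1 cards0.
  rewrite !inE => /andP [wc wK]; exists w => //.
  rewrite cardsDS ?cards2 1?eq_sym ?wc //.
  by apply/subsetP => i; rewrite !inE => /orP [] /eqP ->.
have [f [C [tC [tI _]]]] := turn_in cX xX leX sA sinj.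
have [b1 b1B rb1] : exists2 a, a \in arm (~~ b) & r -- a.
  apply: conn_set_neighbour => //; rewrite -card_gt0.
  exact: leq_trans (arm_card _).
(* The turns stay on [arm b] and [r], hence off the rows of [s] and [b1]. *)
have Cb i p : i \in K -> p \in C i -> (p.2 != s) && (p.2 != b1).
  move=> iK pC; have [_ _ _ _ /(_ p pC)] := tC i iK; rewrite !inE => /andP [_].
  case/orP => [/eqP -> | pA].
    rewrite [r == b1]eq_sym (arm_neq_r b1B) andbT; apply: contraTneq rs => ->.
    by rewrite sedge_irrefl.
  apply/andP; split; first by apply: contraTneq pA => ->.
  by apply: contraTneq pA => ->; have := arm_disj b1B; rewrite negbK.
have sb1 : s != b1 by apply: contraNneq (arm_s (~~ b)) => ->.
exists (K :\: [set c; w]), (fun i => C i :|: (if i == c then setX X [set s] else set0)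
  :|: (if i == w then setX X [set b1] else set0)); split=> //.
- exact: subsetDl.
- move=> i iK; have [fX cC xC rC XC] := tC i iK; split.
  + have cC' : @conn_set H (C i :|: (if i == c then setX X [set s] else set0)).
      by case: ifP => _; rewrite ?setU0 //; exact: (conn_setU_row cX cC fX rC rs).
    case: (i == w); rewrite ?setU0 //; refine (conn_setU_row cX cC' fX _ rb1).
    by rewrite inE rC.
  + by move=> v /set1P ->; rewrite !in_setU xC.
  + move=> [v a] /setUP [/setUP [/XC /andP [] //|]|]; case: ifP; rewrite ?inE // => _ /andP [] //.
- move=> i j iK jK [v a]; rewrite !in_setU => /orP [/orP [] pi|pi] /orP [/orP [] pj|pj];
    first exact: tI pi pj; move: pi pj; do ?[case: eqP => [->|_]]; rewrite ?in_set0 ?in_setX ?in_set1 //=.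
  + by move=> /(Cb _ _ iK) /= /andP [/negbTE ->]; rewrite andbF.
  + by move=> /(Cb _ _ iK) /= /andP [_ /negbTE ->]; rewrite andbF.
  + by move=> /andP [_ as_] /(Cb _ _ jK); rewrite /= as_.
  + by move=> /andP [_ /eqP ->]; rewrite (negbTE sb1) andbF.
  + by move=> /andP [_ ab] /(Cb _ _ jK); rewrite /= ab andbF.
  + by move=> /andP [_ /eqP ->]; rewrite eq_sym (negbTE sb1) andbF.
- move=> i j iK jK ij nU.
  have step k l : k \in K -> l \in K -> k \in [set c; w] ->
    touch (C k :|: (if k == c then setX X [set s] else set0)
             :|: (if k == w then setX X [set b1] else set0))
          (C l :|: (if l == c then setX X [set s] else set0)
             :|: (if l == w then setX X [set b1] else set0)).
    move=> kK lK; have [fX _ _ rC _] := tC l lK.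
    have rC' : (f l, r) \in C l :|: (if l == c then setX X [set s] else set0)
             :|: (if l == w then setX X [set b1] else set0) by rewrite !in_setU rC.
    rewrite !inE => /orP [] /eqP ->.
      apply: touch_row fX rC' rs; rewrite eqxx.
      by rewrite setUAC; apply: subsetUr.
    by apply: touch_row fX rC' rb1; rewrite eqxx; apply: subsetUr.
  move: nU; rewrite !(in_setD, iK, jK) !andbT negb_and !negbK => /orP [iU | jU].
    exact: step.
  by apply: touchC; apply: step.
Qed.

(** Token [c] is served by the row of [s]; the others turn through the row of [r] into the other arm
    over [y] and cross to [E]. *)
Lemma processes_through X x E y z m :
  conn_set X -> x \in X -> #|I| <= #|X| -> [disjoint X & E] ->
  y \in X -> y -- z -> processes E [set z] m -> processes (X :|: E) [set x] m.+1.
Proof.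
move=> cX xX leX dXE yX yz pE b K sigma sA sinj.
have [K0|/set0Pn [c cK]] := eqVneq K set0.
  exists set0, (fun=> set0); rewrite K0 cards0; split=> //.
  - by move=> i; rewrite inE.
  - by move=> i j; rewrite inE.
  - by move=> i j; rewrite inE.
have [f [C tC0]] := turn_in cX xX leX sA sinj; have finj := turn_row tC0.
have fX : {in K, forall i, f i \in X} by move=> i iK; have [] := tC0.1 i iK.
(* Using the same places [f] joins the two turns of token [i] at [(f i, r)]. *)
have [tau [C' [tauA tauinj tC'0]]] := turn_out (~~ b) cX yX fX finj.
have [tC [tI tr]] := tC0; have [tC' [tI' tr']] := tC'0.
pose CC i := C i :|: C' i.
have cCC i : i \in K -> @conn_set H (CC i).
  move=> iK; have [_ cC _ rC _] := tC i iK; have [_ cC' _ rC' _] := tC' i iK.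
  by apply: (conn_setU cC cC' rC rC'); rewrite eqxx.
have rCC i : i \in K -> (f i, r) \in CC i.
  by move=> iK; have [_ _ _ rC _] := tC i iK; rewrite inE rC.
have CCX i p : i \in K -> p \in CC i -> (p.1 \in X) && (p.2 != s).
  move=> iK; have [_ _ _ _ XC] := tC i iK; have [_ _ _ _ XC'] := tC' i iK.
  have ns b' : (p.1 \in X) && (p.2 \in r |: arm b') -> (p.1 \in X) && (p.2 != s).
    case/andP=> -> /setU1P [-> | pA] /=.
      by apply: contraTneq rs => ->; rewrite sedge_irrefl.
    by apply: contraTneq pA => ->.
  by case/setUP => [/XC | /XC']; apply: ns.
have CCd : {in K &, forall i j p, p \in CC i -> p \in CC j -> i = j}.
  (* Turns over different arms can meet only in the row of [r], where each token has the single
     vertex given by the injective [f]. *)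
  suff mixed i j p : i \in K -> j \in K -> p \in C i -> p \in C' j -> i = j.
    move=> i j iK jK p /setUP [] pi /setUP [] pj.
    - exact: tI pi pj.
    - exact: mixed pi pj.
    - exact/esym/(mixed _ _ _ jK iK pj pi).
    - exact: tI' pi pj.
  move=> iK jK pi pj.
  have [_ _ _ _ /(_ p pi) /andP [_ pA]] := tC i iK.
  have [_ _ _ _ /(_ p pj) /andP [_ pA']] := tC' j jK.
  have pr : p.2 = r.
    case/setU1P: pA => // pA; case/setU1P: pA' => // pA'.
    by have := arm_disj pA; rewrite pA'.
  move: pi pj; case: p pr {pA pA'} => v a /= -> pi pj.
  by apply: finj => //; rewrite -(tr i iK v pi) -(tr' j jK v pj).
have [i /setD1P [_ /tauA] //|i j /setD1P [_ iK] /setD1P [_ jK]|U [B [sU cU BK Bd Bt]]] :=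
    pE (~~ b) (K :\ c) tau.
  exact: tauinj.
have BKE i p : i \in K -> i != c -> p \in B i -> (p.1 \in X) = false.
  move=> iK ic pB; have [|_ _ /(_ p pB) pE'] := BK i; first by rewrite !inE ic.
  exact: disjointFl dXE pE'.
exists U, (fun i => CC i :|: if i == c then setX X [set s] else B i); split.
- exact: subset_trans sU (subsetDl _ _).
- by apply: leq_trans cU _; rewrite (cardsD1 c K) cK add1n subSS.
- move=> i iK; have [_ _ xC _ _] := tC i iK; split.
  + case: eqP => [_|/eqP ic]; first exact: (conn_setU_row cX (cCC i iK) (fX i iK) (rCC i iK) rs).
    have [|cB zB _] := BK i; first by rewrite !inE ic.
    apply: (@conn_setU H _ _ (y, tau i) (z, tau i)) => //; first exact: cCC.
    * by have [_ _ yC _ _] := tC' i iK; rewrite inE yC orbT.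
    * by apply: zB; rewrite set11.
    * by rewrite /= /cart_rel /= yz eqxx orbT.
  + by move=> v /set1P ->; rewrite !in_setU xC.
  + move=> p /setUP [/(CCX i p iK) /andP [pX _]|]; first by rewrite inE pX.
    case: eqP => [_|/eqP ic]; first by case: p => v a /setXP [vX _]; rewrite inE vX.
    have [|_ _ BE /BE pE'] := BK i; first by rewrite !inE ic.
    by rewrite inE pE' orbT.
- suff mixed i j p : i \in K -> j \in K -> p \in CC i ->
      p \in (if j == c then setX X [set s] else B j) -> False.
    move=> i j iK jK p /setUP [] pi /setUP [] pj.
    + exact: CCd pi pj.
    + by case: (mixed _ _ _ iK jK pi pj).
    + by case: (mixed _ _ _ jK iK pj pi).
    move: pi pj; case: (eqVneq i c) => [->|ic]; case: (eqVneq j c) => [->|jc] //.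
    + by case: p => v a /setXP [/= vX _] /(BKE _ _ jK jc) /=; rewrite vX.
    + by case: p => v a /(BKE _ _ iK ic) /= nX /setXP [/= vX]; rewrite vX in nX.
    + by apply: Bd; rewrite !inE ?ic ?jc.
  move=> iK jK /(CCX _ _ iK) /andP [pX ps]; case: (eqVneq j c) => [_|jc].
    by case: p pX ps => v a _ /= /negP ns /setXP [_ /set1P /= /eqP].
  by move/(BKE _ _ jK jc); rewrite pX.
- suff row j : j \in K -> touch (CC c :|: if c == c then setX X [set s] else B c)
      (CC j :|: if j == c then setX X [set s] else B j).
    move=> i j iK jK ij nU; case: (eqVneq i c) => [ic|ic].
      by have := row j jK; rewrite ic eqxx.
    case: (eqVneq j c) => [jc|jc].
      by apply: touchC; have := row i iK; rewrite jc eqxx (negbTE ic).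
    apply: touchS (subsetUr _ _) (subsetUr _ _) _.
    by apply: Bt; rewrite ?inE ?ic ?jc.
  move=> jK; apply: (touch_row (v := f j) (X := X) (a := s)) => //.
  + by rewrite eqxx subsetUr.
  + exact: fX.
  + by rewrite inE rCC.
Qed.

(** * Induction over regions that contain given subtrees *)

Definition blocks D (Q : {set {set G}}) :=
  trivIset Q /\ {in Q, forall X, [/\ conn_set X, #|I| <= #|X| & X \subset D]}.

Lemma blocks_sub D D' (Q Q' : {set {set G}}) : Q' \subset Q ->
  {in Q', forall X, X \subset D'} -> blocks D Q -> blocks D' Q'.
Proof.
move=> sQ sD [tQ QD]; split; first exact: trivIsetS sQ tQ.
by move=> X XQ; have [cX lX _] := QD X (subsetP sQ X XQ); split; rewrite ?sD.
Qed.

(** The part of [Z] used up by the blocks in [Q]; components holding only other blocks stay free to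
    be attached. *)
Definition reach (Z : {set G}) (Q : {set {set G}}) :=
  [set v | [exists u in cover Q, v \in component Z u]].

Lemma reach_sub Z Q : blocks Z Q -> reach Z Q \subset Z.
Proof.
case=> _ QZ; apply/subsetP => v; rewrite inE => /exists_inP [u].
case/bigcupP => X /QZ [_ _ /subsetP sX] /sX /component_sub /subsetP; exact.
Qed.

(** The induction hypothesis of [processes_blocks] inside [Z], named so that the component lemmas
    can stand outside that induction. *)
Definition component_processing (Z : {set G}) :=
  forall E z (Q : {set {set G}}), E \subset Z -> conn_set E ->
  z \in E -> blocks E Q -> Q != set0 -> processes E [set z] #|Q|.+1.

(** [E] is the component of [D :\: R] around some block and [Q1] collects the blocks in it. A
    connected block meeting a component lies inside it, so [E] avoids what the other blocks
    reach. *)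
Lemma split_component D R Q : 0 < #|I| -> conn_set D -> R \subset D -> R != set0 ->
  component_processing (D :\: R) -> blocks (D :\: R) Q -> Q != set0 ->
  exists (E : {set G}) (Q1 : {set {set G}}) (y z : G),
    [/\ Q1 \subset Q, Q1 != set0, y \in R & y -- z] /\
    [/\ E \subset D :\: R, E \subset reach (D :\: R) Q, processes E [set z] #|Q1|.+1
      & [disjoint R :|: reach (D :\: R) (Q :\: Q1) & E]].
Proof.
move=> I0 cD sRD R0 pZ bQ /set0Pn [Y YQ]; have [tQ QZ] := bQ.
have [cY lY sY] := QZ Y YQ.
have /card_gt0P [v vY] : 0 < #|Y| by apply: leq_trans lY.
have vZ : v \in D :\: R by apply: (subsetP sY).
have [y [z [yR zE yz]]] := component_neighbour cD sRD R0 vZ.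
have sEZ := component_sub vZ; set E := component _ v in zE sEZ *.
pose Q1 := [set X in Q | X \subset E].
have sQ1 : Q1 \subset Q by apply/subsetP => X; rewrite inE => /andP [].
have Q10 : Q1 != set0.
  apply/set0Pn; exists Y; rewrite inE YQ.
  exact: conn_sub_component cY sY vY (component_refl _ _).
exists E, Q1, y, z; split=> //; split=> //.
  apply/subsetP => u uE; rewrite inE; apply/exists_inP; exists v => //.
  by apply/bigcupP; exists Y.
  apply: pZ => //; first exact: conn_component.
  by apply: (blocks_sub sQ1 _ bQ) => X; rewrite inE => /andP [].
rewrite disjoint_sym; apply/pred0P => u /=; apply/negbTE/negP => /andP [uE].
rewrite inE => /orP [uR | ].
  by have := subsetP sEZ u uE; rewrite inE uR.
rewrite inE => /exists_inP [w /bigcupP [X /setDP [XQ nX] wX] uw].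
case/negP: nX; rewrite inE XQ; have [cX _ sX] := QZ X XQ.
apply: conn_sub_component cX sX wX _.
have eu : component (D :\: R) u = E by apply: component_eq.
by rewrite -/E -eu (component_eq uw) component_refl.
Qed.

(** [R] passes the tokens on and the components are attached one by one. Each serves one token more
    than it has blocks; a single such surplus is recorded, which is all that is used later. *)
Lemma processes_const_region D R Q : 0 < #|I| -> conn_set D -> R \subset D ->
  R != set0 -> conn_set R -> component_processing (D :\: R) ->
  blocks (D :\: R) Q ->
  processes (R :|: reach (D :\: R) Q) R (#|Q| + (Q != set0)).
Proof.
move=> I0 cD sRD R0 cR pZ.
have [k] := ubnP #|Q|; elim: k Q => // k IH Q ltk bQ.
have [->|Q0] := eqVneq Q set0.
  by rewrite cards0; apply: processes_weaken (subsetUl _ _) (subxx R) _ (processes_const cR).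
have [E [Q1 [y [z [[sQ1 Q10 yR yz] [_ sE pE dE]]]]]] :=
  split_component I0 cD sRD R0 pZ bQ Q0.
have cQ : #|Q| = #|Q1| + #|Q :\: Q1|.
  by rewrite [in RHS]cardsD (setIidPr sQ1) subnKC // subset_leq_card.
have Q1_gt0 : 0 < #|Q1| by rewrite card_gt0.
have bQ2 : blocks (D :\: R) (Q :\: Q1).
  by apply: (blocks_sub (subsetDl _ _) _ bQ) => X /setDP [XQ _]; case: (bQ.2 X XQ).
have ltk2 : #|Q :\: Q1| < k by move: ltk; rewrite cQ; lia.
have pW := processes_attach (IH _ ltk2 bQ2) pE dE yR yz.
apply: processes_weaken (subxx R) _ pW; last by rewrite cQ; lia.
rewrite -setUA setUS // subUset sE andbT; apply/subsetP => u; rewrite !inE.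
case/exists_inP=> w /bigcupP [X /setDP [XQ _] wX] uw; apply/exists_inP.
by exists w => //; apply/bigcupP; exists X.
Qed.

Lemma processes_blocks D x Q : 0 < #|I| -> conn_set D -> x \in D -> blocks D Q ->
  Q != set0 -> processes D [set x] #|Q|.+1.
Proof.
move=> I0; have [k] := ubnP #|D|; elim: k D x Q => // k IH D x Q ltk cD xD bQ Q0.
have [tQ QD] := bQ.
have pZ R : R \subset D -> R != set0 -> component_processing (D :\: R).
  move=> sRD /set0Pn [y yR] E z Q' sE cE zE bQ' Q'0; apply: IH => //.
  rewrite -ltnS; apply: leq_trans ltk; rewrite ltnS; apply: proper_card.
  apply/properP; split; first exact: subset_trans sE (subsetDl _ _).
  exists y; first exact: (subsetP sRD).
  by apply/negP => /(subsetP sE); rewrite inE yR.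
have [xQ|xQ] := boolP (x \in cover Q); last first.
  (* The root lies in no block: it only passes tokens on, and the surplus of the components behind
     it suffices. *)
  have sx : [set x] \subset D by rewrite sub1set.
  have x0 : [set x] != set0 by apply/set0Pn; exists x; apply: set11.
  have bQ' : blocks (D :\: [set x]) Q.
    apply: (blocks_sub (subxx Q) _ bQ) => X XQ; have [_ _ sX] := QD X XQ.
    rewrite subsetD sX disjoint_sym disjoints1 /=.
    by apply: contra xQ => xX; apply/bigcupP; exists X.
  have := processes_const_region I0 cD sx x0 (@conn_set1 G x) (pZ _ sx x0) bQ'.
  apply: processes_weaken (subxx _) _; last by rewrite Q0 addn1.
  by rewrite subUset sx (subset_trans (reach_sub bQ') (subsetDl _ _)).
case/bigcupP: xQ => X XQ xX; have [cX lX sX] := QD X XQ.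
have X0 : X != set0 by apply/set0Pn; exists x.
have cQ : #|Q| = #|Q :\ X|.+1 by rewrite (cardsD1 X Q) XQ.
have [QX|QX] := eqVneq (Q :\ X) set0.
  rewrite cQ QX cards0; apply: processes_weaken sX (subxx _) (leqnn _) _.
  exact: processes_leaf.
have bQX : blocks (D :\: X) (Q :\ X).
  apply: (blocks_sub (subsetDl _ _) _ bQ) => Y /setD1P [YX YQ].
  have [_ _ sY] := QD Y YQ; rewrite subsetD sY /=.
  by move/trivIsetP: tQ; apply.
have [E [Q1 [y [z [[sQ1 Q10 yX yz] [sE _ pE dE]]]]]] :=
  split_component I0 cD sX X0 (pZ _ sX X0) bQX QX.
have sED : E \subset D by apply: subset_trans sE (subsetDl _ _).
have cQ1 : #|Q :\ X| = #|Q1| + #|(Q :\ X) :\: Q1|.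
  by rewrite [in RHS]cardsD (setIidPr sQ1) subnKC // subset_leq_card.
have [Q2|Q2] := eqVneq ((Q :\ X) :\: Q1) set0.
  (* All other blocks lie in [E], which serves [#|Q1|.+1] tokens; [X] serves one more. *)
  have dXE : [disjoint X & E] by apply: disjointWl dE; apply: subsetUl.
  have := processes_through cX xX lX dXE yX yz pE.
  apply: processes_weaken (subxx _) _; first by rewrite subUset sX.
  by rewrite cQ cQ1 Q2 cards0 addn0.
(* [X] serves none, but both [E] and the remaining components bring a surplus of one, and one of
   these stands in for [X]. *)
have bQ2 : blocks (D :\: X) ((Q :\ X) :\: Q1).
  by apply: (blocks_sub (subsetDl _ _) _ bQX) => Y /setDP [YQ _]; case: (bQX.2 Y YQ).
have pW := processes_const_region I0 cD sX X0 cX (pZ _ sX X0) bQ2.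
refine (processes_weaken _ _ _ (processes_attach pW pE dE yX yz)).
- by rewrite !subUset sX sED (subset_trans (reach_sub bQ2) (subsetDl _ _)) //.
- by rewrite sub1set.
- by rewrite cQ cQ1 Q2 addn1 addSn addnS addnC.
Qed.


End Product.

(** * From served tokens to a clique minor *)

Lemma connected_setT (G : sgraph) : connected G -> @conn_set G setT.
Proof.
case/andP=> _ /forallP cG x y _ _; rewrite (eq_connect (e' := @sedge G)).
  by have /forallP := cG x; apply.
by move=> u v; rewrite /= /induced_rel !inE.
Qed.

Lemma complete_minor (H : sgraph) (n : nat) (B : 'I_n -> {set H}) :
  (forall i, connected (induced (B i))) ->
  (forall i j, i != j -> [disjoint B i & B j]) ->
  (forall i j, i != j -> exists x y, [/\ x \in B i, y \in B j & x -- y]) ->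
  minor H (complete n).
Proof.
move=> cB dB tB; apply/existsP; exists [ffun i : complete n => B i].
apply/and3P; split.
- by apply/forallP => i; rewrite ffunE.
- by apply/forallP => i; apply/forallP => j; rewrite !ffunE; apply/implyP/dB.
- apply/forallP => i; apply/forallP => j; rewrite !ffunE; apply/implyP => /tB.
  case=> x [y [xB yB xy]]; apply/exists_inP; exists x => //.
  by apply/exists_inP; exists y.
Qed.

Theorem mainTheorem10 (n : nat) (n_gt0 : 0 < n) (G : sgraph)
    (treeG : is_tree G) (X : 'I_n -> subgraph G)
    (treeX : forall i, is_tree (X i))
    (disjX : forall i j, i != j -> [disjoint sub_verts (X i) & sub_verts (X j)])
    (cardX : forall i, n <= #|sub_verts (X i)|) :
  forall T : sgraph, is_balance n T -> n <= hadwiger (cart_prod G T).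
Proof.
move=> T [_ [r [s [A [B [rs [sA sB] dAB [cA cB] [[tA _] [tB _]]]]]]]].
pose arm b := if b then A else B.
have conn_arm b : conn_set (r |: arm b).
  by case: b; [apply: (connected_conn_set tA) | apply: (connected_conn_set tB)].
have arm_rs b a : a \in arm b -> a != r /\ a != s.
  have := subsetP sA a; have := subsetP sB a; rewrite !inE !negb_or => hB hA.
  by case: b => [/hA | /hB] /andP.
have arm_r b : r \notin arm b by apply/negP => /arm_rs []; rewrite eqxx.
have arm_s b : s \notin arm b by apply/negP => /arm_rs [_]; rewrite eqxx.
have arm_disj b a : a \in arm b -> a \notin arm (~~ b).
  by case: b => /= aA; [rewrite (disjointFr dAB aA) | rewrite (disjointFl dAB aA)].
have arm_card b : #|'I_n| <= #|arm b| by rewrite card_ord; case: b.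
pose Q := [set sub_verts (X i) | i : 'I_n].
(* Disjoint nonempty sets are distinct, so the set [Q] has exactly [n] blocks. *)
have injX : injective (fun i => sub_verts (X i)).
  move=> i j Xij; apply/eqP/negPn/negP => /disjX; rewrite Xij -setI_eq0 setIid.
  by move=> /eqP X0; have := cardX j; rewrite X0 cards0 leqNgt n_gt0.
have cQ : #|Q| = n by rewrite card_imset // card_ord.
have /card_gt0P [x _] : 0 < #|G| by case/andP: treeG.1.
have bQ : blocks 'I_n setT Q.
  split.
    apply/trivIsetP => _ _ /imsetP [i _ ->] /imsetP [j _ ->] neq.
    by apply: disjX; apply: contraNneq neq => ->.
  move=> _ /imsetP [i _ ->]; rewrite subsetT card_ord; split=> //.
  exact: connected_conn_set (treeX i).1.
have Q0 : Q != set0 by rewrite -card_gt0 cQ.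
(* Constant weights: the matching only supplies an injection of the tokens into an arm, as starting
   positions. *)
have [|sigma [sA' sinj _]] :=
  @monotone_matching _ _ (fun=> 0) (fun=> 0) [set: 'I_n] (arm true) r _.
  by rewrite cardsT.
have I0 : 0 < #|'I_n| by rewrite card_ord.
have [U [C [_ cU CK Cd Ct]]] :=
  processes_blocks rs conn_arm arm_r arm_s arm_disj arm_card I0
    (connected_setT treeG.1) (in_setT x) bQ Q0 sA' sinj.
(* Up to [n.+1] tokens can be served and there are only [n], so all pairs touch. *)
have U0 : U = set0.
  by apply/eqP; rewrite -cards_eq0 -leqn0; apply: leq_trans cU _; rewrite cQ cardsT card_ord leqn0 subn_eq0.
apply/leq_hadwiger/(complete_minor (B := C)).
- move=> i; have [cC xC _] := CK i (in_setT i).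
  by apply: conn_set_connected cC; apply: xC; apply: set11.
- move=> i j ij; apply/pred0P => p /=; apply/negP => /andP [pi pj].
  by case/eqP: ij; apply: Cd pi pj; rewrite inE.
- by move=> i j ij; apply: Ct; rewrite ?U0 ?inE.
Qed.
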